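(* Let $A,B,C\in M_n(\mathbb{C})$ be self-adjoint matrices such that $A\leq B\leq C$. Let $D=A+C-B$. The following are true: (1) $\det e^A\,\det e^C=\det e^B\,\det e^D$; (2) $\det e^{B^2}\,\det e^{D^2}\leq\det e^{A^2}\,\det e^{C^2}$, and thus $\|B\|_F+\|D\|_F\leq\|A\|_F+\|C\|_F$; (3) for all $t\in\left(-\frac{1}{\|A\|},\frac{1}{\|C\|}\right)$, $$\det(1-tA)\,\det(1-tC)\leq\det(1-tB)\,\det(1-tD).$$
   Context: $M_n(\mathbb{C})$ is the set of $n\times n$ complex matrices. For self-adjoint matrices, $A\leq B$ means that $B-A$ is positive semidefinite. $\|\cdot\|_F$ is the Frobenius norm, $\|\cdot\|$ is the operator norm, and $1$ denotes the identity matrix.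
   Formalization: In (2) the Frobenius inequality is proved for squared norms, ‖B‖_F²+‖D‖_F² ≤ ‖A‖_F²+‖C‖_F²; the printed unsquared one is false: A=0, B=diag(1,0), C=1, D=diag(0,1) would give 2 ≤ √2. *)

(* Defs.v *)
From HB Require Import structures.
From mathcomp Require Import all_boot all_order all_algebra.
From mathcomp Require Import all_classical all_reals all_analysis.
From mathcomp Require Import complex.

Set Implicit Arguments.
Unset Strict Implicit.
Unset Printing Implicit Defensive.

Import Order.TTheory GRing.Theory Num.Theory.
Import numFieldNormedType.Exports.

Local Open Scope classical_set_scope.
Local Open Scope ring_scope.
Local Open Scope complex_scope.
Local Open Scope sesquilinear_scope.

Definition psdmx (R : realType) (n : nat) (M : 'M[R[i]]_n) : Prop :=
  M \is hermsymmx /\ forall v : 'cV[R[i]]_n, 0 <= (v^t* *m M *m v) 0 0.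

Definition lemx (R : realType) (n : nat) (A B : 'M[R[i]]_n) : Prop :=
  psdmx (B - A).

(* The limit is taken in the normed space of matrices; [lim] is a total
   operator, but this power series converges for every A. *)
Definition expmx (R : realType) (n : nat) (A : 'M[R[i]]_n) : 'M[R[i]]_n :=
  lim (series (fun k => k`!%:R^-1 *: A ^+ k) @ \oo).

(* Pitfall: the trace inequality tr B^2 + tr D^2 <= tr A^2 + tr C^2 is about the
   squares of Frobenius norms.  The unsquared |B|+|D| <= |A|+|C| is false: take
   A = 0, B = diag(1,0), C = 1, D = diag(0,1), where it would read
   2 <= sqrt 2. *)
Definition frob_norm (R : realType) (m n : nat) (A : 'M[R[i]]_(m, n)) : R :=
  Num.sqrt (\sum_i \sum_j ComplexField.Normc.normc (A i j) ^+ 2).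

Definition l2_norm (R : realType) (n : nat) (v : 'cV[R[i]]_n) : R :=
  Num.sqrt (\sum_i ComplexField.Normc.normc (v i 0) ^+ 2).

(* Bounds of the form 1 / op_norm A are taken in \bar R, where 0^-1 = +oo;
   in R itself 0^-1 is 0, which would cut the interval at 0 when A = 0. *)
Definition op_norm (R : realType) (n : nat) (A : 'M[R[i]]_n) : R :=
  sup [set l2_norm (A *m v) | v in [set v : 'cV[R[i]]_n | l2_norm v <= 1]].

(* Main.v *)
Require Import Defs.
From HB Require Import structures.
From mathcomp Require Import all_boot all_order all_algebra.
From mathcomp Require Import all_classical all_reals all_analysis.
From mathcomp Require Import complex.
From mathcomp Require Import ring.

(* Write B = A + P, C = A + P + Q and D = A + Q with P, Q >= 0.  Since
   det e^M = e^(tr M) for self-adjoint M, (1) is tr A + tr C = tr B + tr D, and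
   (2) follows from
     tr A^2 + tr C^2 - tr B^2 - tr D^2 = 2 tr (P Q) >= 0.
   For (3), t ranges over an interval where 1 - tC > 0 (if t >= 0) or
   1 - tA > 0 (if t <= 0), so it suffices that
     det X det (X + P + Q) <= det (X + P) det (X + Q)   for X > 0.
   Adding to Q one rank-one term w w' at a time (w' the adjoint of w), the matrix
   determinant lemma det (Y + w w') = det Y (1 + w' Y^-1 w) reduces this to
   w' (X + P)^-1 w <= w' X^-1 w. *)

Set Implicit Arguments.
Unset Strict Implicit.
Unset Printing Implicit Defensive.

Import Order.TTheory GRing.Theory Num.Theory.
Import numFieldNormedType.Exports.

Local Open Scope ring_scope.
Local Open Scope complex_scope.
Local Open Scope sesquilinear_scope.

(** * Hermitian matrices: spectral theory, determinant and trace inequalities *)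

Section HermitianForms.
Variable C : numClosedFieldType.

Definition posdefmx n (M : 'M[C]_n) : Prop :=
  M \is hermsymmx /\ forall v : 'cV[C]_n, v != 0 -> 0 < (v^t* *m M *m v) 0 0.

Lemma hermsymmxP n (M : 'M[C]_n) : reflect (M^t* = M) (M \is hermsymmx).
Proof.
apply: (iffP (is_hermitianmxP _ _ _)); rewrite expr0 scale1r; exact: esym.
Qed.

Lemma hermsymmxD n (M N : 'M[C]_n) :
  M \is hermsymmx -> N \is hermsymmx -> M + N \is hermsymmx.
Proof.
move=> /hermsymmxP hM /hermsymmxP hN; apply/hermsymmxP.
by rewrite linearD map_mxD hM hN.
Qed.

Lemma trmxC_scale m n (a : C) (M : 'M[C]_(m, n)) :
  (a *: M)^t* = a^*%R *: M^t*.
Proof. by apply/matrixP => i j; rewrite !mxE rmorphM. Qed.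

Lemma hermsymmxZ n (a : C) (M : 'M[C]_n) :
  a \is Num.real -> M \is hermsymmx -> a *: M \is hermsymmx.
Proof.
move=> /CrealP ar /hermsymmxP hM; apply/hermsymmxP.
by rewrite trmxC_scale hM ar.
Qed.

Lemma trmxC_mul m n p (M : 'M[C]_(m, n)) (N : 'M[C]_(n, p)) :
  (M *m N)^t* = N^t* *m M^t*.
Proof. by rewrite trmx_mul map_mxM. Qed.

Lemma hermsymmx_sqr n (M : 'M[C]_n) : M \is hermsymmx -> M ^+ 2 \is hermsymmx.
Proof.
by move=> /hermsymmxP hM; apply/hermsymmxP; rewrite expr2 trmxC_mul hM.
Qed.

Lemma hermsymmx_outer n (v : 'cV[C]_n) : v *m v^t* \is hermsymmx.
Proof. by apply/hermsymmxP; rewrite trmxC_mul trmxCK. Qed.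

Lemma diag_form n (d : 'rV[C]_n) (v : 'cV[C]_n) :
  (v^t* *m diag_mx d *m v) 0 0 = \sum_i d 0 i * `|v i 0| ^+ 2.
Proof.
rewrite !mxE; apply: eq_bigr => i _.
by rewrite mul_mx_diag !mxE normCK; ring.
Qed.

Lemma hermitian_spectral n (M : 'M[C]_n) : M \is hermsymmx ->
  M = (spectralmx M)^t* *m diag_mx (spectral_diag M) *m spectralmx M.
Proof.
move=> /hermitian_normalmx /orthomx_spectralP.
by rewrite invmx_unitary ?spectral_unitarymx.
Qed.

Lemma unitary_adjointK n (U : 'M[C]_n) : U \is unitarymx -> U^t* *m U = 1%:M.
Proof.
by move=> hU; rewrite -invmx_unitary // mulVmx // unitarymx_unit.
Qed.

(** With M = U' diag(d) U and U = [spectralmx M], the eigenvectors of M are the columns of U', that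
    is, the adjoints of the rows of U. *)
Definition spectral_vec n (M : 'M[C]_n) (i : 'I_n) : 'cV[C]_n :=
  (row i (spectralmx M))^t*.

Lemma spectral_vec_unit n (M : 'M[C]_n) i :
  ((spectral_vec M i)^t* *m spectral_vec M i) 0 0 = 1.
Proof.
rewrite /spectral_vec trmxCK rowE trmxC_mul mulmxA mulmxtVK ?spectral_unitarymx //.
by rewrite trmx_delta map_delta_mx mul_delta_mx !mxE !eqxx.
Qed.

Lemma spectral_vec_neq0 n (M : 'M[C]_n) i : spectral_vec M i != 0.
Proof.
apply/eqP => v0; have /eqP := spectral_vec_unit M i.
by rewrite v0 mulmx0 mxE eq_sym oner_eq0.
Qed.

Lemma spectral_vec_eigen n (M : 'M[C]_n) i : M \is hermsymmx ->
  M *m spectral_vec M i = spectral_diag M 0 i *: spectral_vec M i.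
Proof.
move=> hM; have hU := spectral_unitarymx M.
rewrite {1}(hermitian_spectral hM) /spectral_vec rowE trmxC_mul.
rewrite !mulmxA mulmxtVK // -mulmxA scalemxAr; congr (_ *m _).
apply/colP => j; rewrite trmx_delta map_delta_mx -colE !mxE eqxx andbT.
by case: eqVneq => [->|_]; rewrite ?mulr1n ?mulr1 ?mulr0n ?mulr0.
Qed.

Lemma spectral_vec_form n (M : 'M[C]_n) i : M \is hermsymmx ->
  ((spectral_vec M i)^t* *m M *m spectral_vec M i) 0 0 = spectral_diag M 0 i.
Proof.
move=> hM; rewrite -mulmxA spectral_vec_eigen // -scalemxAr mxE.
by rewrite spectral_vec_unit mulr1.
Qed.

Lemma det_spectral n (M : 'M[C]_n) : M \is hermsymmx ->
  \det M = \prod_i spectral_diag M 0 i.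
Proof.
move=> hM; rewrite {1}(hermitian_spectral hM) !det_mulmx mulrAC -det_mulmx.
by rewrite unitary_adjointK ?spectral_unitarymx // det1 mul1r det_diag.
Qed.

Lemma posdefmx_det_gt0 n (M : 'M[C]_n) : posdefmx M -> 0 < \det M.
Proof.
move=> [hM pM]; rewrite det_spectral //; apply: prodr_gt0 => i _.
by rewrite -spectral_vec_form // pM // spectral_vec_neq0.
Qed.

Lemma posdefmx_unit n (M : 'M[C]_n) : posdefmx M -> M \in unitmx.
Proof.
by move=> /posdefmx_det_gt0 dM; rewrite unitmxE unitfE gt_eqF.
Qed.

(** The form at v is the diagonal form at U v, a sum of nonnegative terms d_i |(U v)_i|^2. It
    vanishes only if U v = 0, and then v = U' U v = 0. *)
Lemma posdefmx_unitary_diag n (U : 'M[C]_n) (d : 'rV[C]_n) :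
  U \is unitarymx -> (forall i, 0 < d 0 i) ->
  posdefmx (U^t* *m diag_mx d *m U).
Proof.
move=> hU pd; split=> [|v v0].
  apply/hermsymmxP; rewrite !trmxC_mul trmxCK tr_diag_mx map_diag_mx mulmxA.
  congr (_ *m diag_mx _ *m _); apply/rowP => i.
  by rewrite mxE /= geC0_conj // ltW.
have -> : v^t* *m (U^t* *m diag_mx d *m U) *m v
        = (U *m v)^t* *m diag_mx d *m (U *m v).
  by rewrite trmxC_mul !mulmxA.
have Uv0 : U *m v != 0.
  apply: contra v0 => /eqP Uv0.
  by rewrite -[v]mul1mx -(unitary_adjointK hU) -mulmxA Uv0 mulmx0.
rewrite diag_form lt_def sumr_ge0 ?andbT; last first.
  by move=> i _; rewrite mulr_ge0 ?exprn_ge0 ?normr_ge0 ?ltW.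
apply: contra Uv0; rewrite psumr_eq0 => [/allP Uv0|i _]; last first.
  by rewrite mulr_ge0 ?exprn_ge0 ?normr_ge0 ?ltW.
apply/eqP/colP => i; have := Uv0 i (mem_index_enum _).
by rewrite implyTb mulf_eq0 gt_eqF //= sqrf_eq0 normr_eq0 => /eqP ->; rewrite mxE.
Qed.

Lemma posdefmxD n (M N : 'M[C]_n) : posdefmx M -> N \is hermsymmx ->
  (forall v : 'cV[C]_n, 0 <= (v^t* *m N *m v) 0 0) -> posdefmx (M + N).
Proof.
move=> [hM pM] hN pN; split=> [|v v0]; first exact: hermsymmxD.
by rewrite mulmxDr mulmxDl mxE ltr_wpDr ?pM ?pN.
Qed.

Lemma outer_form_ge0 n (w v : 'cV[C]_n) : 0 <= (v^t* *m (w *m w^t*) *m v) 0 0.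
Proof.
have -> : v^t* *m (w *m w^t*) *m v = (v^t* *m w) *m (v^t* *m w)^t*.
  by rewrite trmxC_mul trmxCK !mulmxA.
by rewrite mxE sumr_ge0 // => i _; rewrite !mxE mul_conjC_ge0.
Qed.

(** Scaling each unit eigenvector by the square root of its eigenvalue turns the spectral
    decomposition into a sum of rank-one terms. The eigenvalues are nonnegative because each is the
    value of the form at its eigenvector. *)
Lemma psd_sum_outer n (M : 'M[C]_n) : M \is hermsymmx ->
  (forall v : 'cV[C]_n, 0 <= (v^t* *m M *m v) 0 0) ->
  exists s : seq 'cV[C]_n, M = \sum_(v <- s) v *m v^t*.
Proof.
move=> hM pM.
exists [seq sqrtC (spectral_diag M 0 i) *: spectral_vec M i | i : 'I_n].
rewrite big_image /=.
rewrite {1}(hermitian_spectral hM); apply/matrixP => i j.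
rewrite mul_mx_diag summxE !mxE; apply: eq_bigr => k _.
have dk : 0 <= spectral_diag M 0 k by rewrite -spectral_vec_form.
rewrite trmxC_scale -scalemxAl -scalemxAr scalerA.
rewrite geC0_conj ?sqrtC_ge0 // -expr2 sqrtCK !mxE big_ord1 !mxE conjCK.
by rewrite mulrCA mulrA.
Qed.

(** The bordered matrix with blocks Y, -u, v, 1 is multiplied by two unipotent block matrices, one
    clearing v and the other clearing -u. Neither changes its determinant, so the two
    block-triangular results have equal determinants. *)
Lemma det_rank1_update n (Y : 'M[C]_n) (u : 'cV[C]_n) (v : 'rV[C]_n) :
  Y \in unitmx -> \det (Y + u *m v) = \det Y * (1 + (v *m invmx Y *m u) 0 0).
Proof.
move=> uY.
have e : block_mx Y (- u) v 1%:M *m block_mx 1%:M 0 (- v) 1%:M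
         = block_mx (Y + u *m v) (- u) 0 1%:M.
  rewrite mulmx_block !mulmx1 !mulmx0 !mul1mx mulNmx mulmxN opprK subrr.
  by rewrite !add0r.
have f : block_mx Y (- u) v 1%:M *m block_mx 1%:M (invmx Y *m u) 0 1%:M
         = block_mx Y 0 v (1%:M + v *m invmx Y *m u).
  rewrite mulmx_block !mulmx1 !mulmx0 mulKVmx // subrr.
  by rewrite !addr0 addrC mulmxA.
have := congr1 determinant f; have := congr1 determinant e.
rewrite !det_mulmx !det_ublock !det_lblock !det1 !mulr1 => -> ->.
by rewrite det_mx11 mxE mxE eqxx.
Qed.

(* With u = Y^-1 w and v = X^-1 w, expand 0 <= (u - v)' X (u - v). *)
Lemma inv_form_antitone n (X P : 'M[C]_n) (w : 'cV[C]_n) :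
  posdefmx X -> P \is hermsymmx ->
  (forall v : 'cV[C]_n, 0 <= (v^t* *m P *m v) 0 0) ->
  (w^t* *m invmx (X + P) *m w) 0 0 <= (w^t* *m invmx X *m w) 0 0.
Proof.
move=> pX hP pP; have pY := posdefmxD pX hP pP.
have uX := posdefmx_unit pX; have uY := posdefmx_unit pY.
case: (pX) => hX fX.
set Y := X + P in pY uY *; have hY : Y \is hermsymmx by case: pY.
pose u := invmx Y *m w; pose v := invmx X *m w.
have eu : Y *m u = w by rewrite mulKVmx.
have ev : X *m v = w by rewrite mulKVmx.
have eua : w^t* = u^t* *m Y by rewrite -{1}eu trmxC_mul (hermsymmxP _ hY).
have eva : w^t* = v^t* *m X by rewrite -{1}ev trmxC_mul (hermsymmxP _ hX).
have -> : w^t* *m invmx Y *m w = u^t* *m Y *m u by rewrite -mulmxA -/u eua.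
have -> : w^t* *m invmx X *m w = v^t* *m X *m v by rewrite -mulmxA -/v eva.
(* Since X v = Y u = w, both cross terms of the expansion collapse to u' Y u. The difference of the
   two inverse forms is then the form of X at u - v plus the form of P at u. *)
have eux : u^t* *m X *m v = u^t* *m Y *m u by rewrite -mulmxA ev -mulmxA eu.
have exu : v^t* *m X *m u = u^t* *m Y *m u by rewrite -eva eua.
have le : 0 <= ((u - v)^t* *m X *m (u - v)) 0 0.
  have [->|d0] := eqVneq (u - v) 0; first by rewrite mulmx0 mxE.
  exact/ltW/fX.
rewrite -subr_ge0.
suff -> : (v^t* *m X *m v) 0 0 - (u^t* *m Y *m u) 0 0
    = ((u - v)^t* *m X *m (u - v)) 0 0 + (u^t* *m P *m u) 0 0.
  by rewrite addr_ge0.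
have -> : (u - v)^t* *m X *m (u - v) =
    u^t* *m X *m u - u^t* *m Y *m u - (u^t* *m Y *m u - v^t* *m X *m v).
  have -> : (u - v)^t* = u^t* - v^t*.
    by apply/matrixP => i j; rewrite !mxE rmorphB.
  by rewrite mulmxBr !mulmxBl eux exu.
have -> : u^t* *m Y *m u = u^t* *m X *m u + u^t* *m P *m u.
  by rewrite mulmxDr mulmxDl.
by rewrite !mxE; ring.
Qed.

Lemma det_add_submul n (X P : 'M[C]_n) (s : seq 'cV[C]_n) :
  posdefmx X -> P \is hermsymmx ->
  (forall v : 'cV[C]_n, 0 <= (v^t* *m P *m v) 0 0) ->
  \det X * \det (X + P + \sum_(v <- s) v *m v^t*)
    <= \det (X + P) * \det (X + \sum_(v <- s) v *m v^t*).
Proof.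
move=> pX hP pP; elim/last_ind: s => [|s w IH].
  by rewrite !big_nil !addr0 mulrC.
rewrite -cats1 !big_cat !big_seq1 /=.
set Q := \sum_(v <- s) v *m v^t* in IH *.
have [hQ pQ] : Q \is hermsymmx /\
    forall v : 'cV[C]_n, 0 <= (v^t* *m Q *m v) 0 0.
  rewrite /Q; elim: (s) => [|z t [hQ pQ]].
    rewrite big_nil; split=> [|v]; last by rewrite mulmx0 mul0mx mxE.
    by apply/hermsymmxP; rewrite trmx0 map_mx0.
  rewrite big_cons; split=> [|v].
    by rewrite hermsymmxD ?hermsymmx_outer.
  by rewrite mulmxDr mulmxDl mxE addr_ge0 ?outer_form_ge0.
have pXQ := posdefmxD pX hQ pQ; have pXQP := posdefmxD pXQ hP pP.
(* The sum is reordered so that X + Q is the base and P the increment: the two rank-one factors then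
   involve (X + Q + P)^-1 and (X + Q)^-1, which [inv_form_antitone] compares. *)
rewrite !addrA; have -> : X + P + Q = X + Q + P by rewrite addrAC.
rewrite !det_rank1_update ?posdefmx_unit // !mulrA.
(* Multiplying the induction hypothesis by the comparison of the factors requires the smaller factor
   to be nonnegative. This holds as w' Y^-1 w is the form of Y at Y^-1 w. *)
have inv0 : 0 <= (w^t* *m invmx (X + Q + P) *m w) 0 0.
  have uY := posdefmx_unit pXQP; set Y := X + Q + P in pXQP uY *.
  have hY : Y \is hermsymmx by case: pXQP.
  have [->|w0] := eqVneq w 0; first by rewrite mulmx0 mxE.
  have -> : w^t* *m invmx Y *m w = (invmx Y *m w)^t* *m Y *m (invmx Y *m w).
    by rewrite -mulmxA -{1}[w](mulKVmx uY) trmxC_mul (hermsymmxP _ hY) !mulmxA.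
  apply/ltW; case: pXQP => _; apply.
  by apply: contra w0 => /eqP e; rewrite -[w](mulKVmx uY) e mulmx0.
apply: ler_pM => //.
- rewrite mulr_ge0 // ltW //; exact: posdefmx_det_gt0.
- by rewrite addr_ge0.
- by rewrite -(addrAC X P Q).
- by rewrite lerD2l inv_form_antitone.
Qed.

Lemma det_add_submul_psd n (X P Q : 'M[C]_n) : posdefmx X ->
  P \is hermsymmx -> (forall v : 'cV[C]_n, 0 <= (v^t* *m P *m v) 0 0) ->
  Q \is hermsymmx -> (forall v : 'cV[C]_n, 0 <= (v^t* *m Q *m v) 0 0) ->
  \det X * \det (X + P + Q) <= \det (X + P) * \det (X + Q).
Proof.
by move=> pX hP pP hQ /(psd_sum_outer hQ)[s ->]; exact: det_add_submul.
Qed.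

(** Once P is a sum of terms v v', cyclicity of the trace gives tr (v v' Q) = v' Q v. *)
Lemma mxtrace_psd_mul n (P Q : 'M[C]_n) : P \is hermsymmx ->
  (forall v : 'cV[C]_n, 0 <= (v^t* *m P *m v) 0 0) ->
  (forall v : 'cV[C]_n, 0 <= (v^t* *m Q *m v) 0 0) ->
  0 <= \tr (P *m Q).
Proof.
move=> hP /(psd_sum_outer hP)[s ->] pQ.
rewrite mulmx_suml raddf_sum sumr_ge0 // => v _.
by rewrite /= -mulmxA mxtrace_mulC trace_mx11.
Qed.

Lemma mxtrace_sqr_add_le n (A P Q : 'M[C]_n) : P \is hermsymmx ->
  (forall v : 'cV[C]_n, 0 <= (v^t* *m P *m v) 0 0) ->
  (forall v : 'cV[C]_n, 0 <= (v^t* *m Q *m v) 0 0) ->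
  \tr ((A + P) ^+ 2) + \tr ((A + Q) ^+ 2)
    <= \tr (A ^+ 2) + \tr ((A + P + Q) ^+ 2).
Proof.
move=> hP pP pQ; rewrite -subr_ge0.
suff -> : \tr (A ^+ 2) + \tr ((A + P + Q) ^+ 2)
    - (\tr ((A + P) ^+ 2) + \tr ((A + Q) ^+ 2)) = \tr (P *m Q) *+ 2.
  by rewrite mulrn_wge0 // mxtrace_psd_mul.
(* All products involving A cancel, as do the squares of P and Q; what is left is tr (P Q) + tr (Q
   P). *)
rewrite !expr2 -!mulmxE !mulmxDl !mulmxDr !mxtraceD (mxtrace_mulC Q P).
by ring.
Qed.

End HermitianForms.

(** * The matrix exponential and its determinant *)

Section MatrixExponential.
Local Open Scope classical_set_scope.

(** Balls of matrices are entrywise, and finitely many eventual conditions hold eventually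
    together. *)
Lemma cvg_mx (K : numFieldType) m n (u : nat -> 'M[K]_(m, n)) (M : 'M[K]_(m, n)) :
  (forall i j, u k i j @[k --> \oo] --> M i j) -> u @ \oo --> M.
Proof.
move=> uM; apply/cvg_ballP => e e0.
have: \forall k \near \oo, forall i j, ball (M i j) e (u k i j).
  apply: filter_forall => i; apply: filter_forall => j.
  exact: (cvg_ballP _ _).1 (uM i j) e e0.
by apply: filterS.
Qed.

Lemma expr_unitary_conj (C : numClosedFieldType) n (U : 'M[C]_n) (d : 'rV[C]_n) k :
  U \is unitarymx ->
  (U^t* *m diag_mx d *m U) ^+ k
    = U^t* *m diag_mx (\row_i d 0 i ^+ k) *m U.
Proof.
move=> hU; elim: k => [|k IH].
  rewrite expr0 (_ : \row_i _ = const_mx 1).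
    by rewrite diag_const_mx mulmx1 unitary_adjointK.
  by apply/rowP=> i; rewrite !mxE expr0.
rewrite exprSr IH -!mulmxE !mulmxA mulmxtVK // -(mulmxA (U^t*)) mulmx_diag.
by congr (_ *m diag_mx _ *m _); apply/rowP=> i; rewrite !mxE exprSr.
Qed.

(** Powers commute with unitary conjugation, so each entry of a partial sum is a fixed finite linear
    combination of partial sums of the scalar series at the d_l. *)
Lemma cvg_series_exp_unitary (C : numClosedFieldType) n (U : 'M[C]_n)
    (d e : 'rV[C]_n) :
  U \is unitarymx ->
  (forall i, series (fun k => k`!%:R^-1 * d 0 i ^+ k) @ \oo --> e 0 i) ->
  series (fun k => k`!%:R^-1 *: (U^t* *m diag_mx d *m U) ^+ k) @ \oo
    --> U^t* *m diag_mx e *m U.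
Proof.
move=> hU de; apply: cvg_mx => i j.
have -> : (U^t* *m diag_mx e *m U) i j = \sum_l (U l i)^*%R * e 0 l * U l j.
  by rewrite mul_mx_diag mxE; apply: eq_bigr => l _; rewrite !mxE.
have -> : (fun N =>
    (series (fun k => k`!%:R^-1 *: (U^t* *m diag_mx d *m U) ^+ k) N) i j)
  = (fun N => \sum_l
      (U l i)^*%R * series (fun k => k`!%:R^-1 * d 0 l ^+ k) N * U l j).
  apply/funext => N; rewrite /series /= summxE.
  under [RHS]eq_bigr => l _ do rewrite mulr_sumr mulr_suml.
  rewrite exchange_big /=; apply: eq_bigr => k _.
  rewrite expr_unitary_conj // mul_mx_diag !mxE mulr_sumr.
  by apply: eq_bigr => l _; rewrite !mxE; ring.
apply: cvg_big => [|l _]; first exact: add_continuous.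
apply: cvgM; last exact: cvg_cst.
by apply: cvgM; [exact: cvg_cst|exact: de].
Qed.

Lemma cvg_series_expR (R : realType) (x : R) :
  let K : numFieldType := R[i] in
  (series (fun k => k`!%:R^-1 * x%:C ^+ k) : nat -> K) @ \oo
    --> ((expR x)%:C : K).
Proof.
move=> K; have -> : series (fun k => k`!%:R^-1 * x%:C ^+ k)
    = (fun N => (series (exp_coeff x) N)%:C).
  apply/funext => N; rewrite /series /= rmorph_sum; apply: eq_bigr => k _.
  by rewrite exp_coeffE rmorphM rmorphXn fmorphV rmorph_nat.
apply/cvgrPdist_lt => e e0.
(* The radius e is an element of [R[i]]; being positive, it is real, so the convergence of the real
   series applies to it. *)
have ee : (e : R[i]) = (complex.Re e)%:C by rewrite RRe_real // gtr0_real.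
rewrite ee ltcR in e0.
have /cvgrPdist_lt/(_ _ e0) := is_cvg_series_exp_coeff x.
apply: filterS => N; rewrite -/(expR x) ee -rmorphB normc_def /=.
by rewrite expr0n addr0 sqrtr_sqr ltcR.
Qed.

(** In an eigenbasis the determinant is the product of the exponentials of the eigenvalues, which
    are real; hence the real part, which lets [expR] be applied to the trace. *)
Lemma det_expmx (R : realType) n (A : 'M[R[i]]_n) : A \is hermsymmx ->
  \det (expmx A) = (expR (complex.Re (\tr A)))%:C.
Proof.
move=> hA; pose U := spectralmx A; pose d := spectral_diag A.
have hU : U \is unitarymx by exact: spectral_unitarymx.
have eA : A = U^t* *m diag_mx d *m U by exact: hermitian_spectral.
have dr i : d 0 i = (complex.Re (d 0 i))%:C.
  by rewrite RRe_real //; exact: (mxOverP (hermitian_spectral_diag_real hA)).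
have -> : expmx A = U^t* *m diag_mx (\row_i (expR (complex.Re (d 0 i)))%:C) *m U.
  (* The total operator [lim] is evaluated here: convergence is proved and limits are unique in a
     Hausdorff space. *)
  apply: (@cvg_lim ('M[(R[i] : numFieldType)]_n : normedModType _)).
    exact: norm_hausdorff.
  rewrite {1}eA; apply: cvg_series_exp_unitary => // i.
  by rewrite mxE dr /=; exact: cvg_series_expR.
rewrite !det_mulmx mulrAC -det_mulmx unitary_adjointK // det1 mul1r det_diag.
have -> : \tr A = \sum_i d 0 i.
  by rewrite eA mxtrace_mulC mulmxA (unitarymxP hU) mul1mx mxtrace_diag.
rewrite raddf_sum expR_sum rmorph_prod.
by apply: eq_bigr => i _; rewrite mxE.
Qed.

Lemma det_expmx_mul (R : realType) n (A B : 'M[R[i]]_n) :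
  A \is hermsymmx -> B \is hermsymmx ->
  \det (expmx A) * \det (expmx B) = (expR (complex.Re (\tr A + \tr B)))%:C.
Proof.
move=> hA hB.
apply: etrans (congr2 *%R (det_expmx hA) (det_expmx hB)) _.
have -> (x y : R[i]) : complex.Re (x + y) = complex.Re x + complex.Re y.
  by case: x; case: y.
by rewrite expRD -(rmorphM (real_complex R)).
Qed.

Lemma det_expmx_mul_le (R : realType) n (A B A' B' : 'M[R[i]]_n) :
  A \is hermsymmx -> B \is hermsymmx -> A' \is hermsymmx -> B' \is hermsymmx ->
  \tr A + \tr B <= \tr A' + \tr B' ->
  \det (expmx A) * \det (expmx B) <= \det (expmx A') * \det (expmx B').
Proof.
move=> hA hB hA' hB' le_tr; rewrite lecE in le_tr.
case/andP: le_tr => _ le_tr.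
rewrite [leLHS](det_expmx_mul hA hB).
rewrite [leRHS](det_expmx_mul hA' hB').
by rewrite lecR ler_expR.
Qed.

End MatrixExponential.

(** * Frobenius, Euclidean and operator norms over the complex numbers *)

Section ComplexNorms.
Local Open Scope classical_set_scope.
Variable R : realType.
Local Notation normc := ComplexField.Normc.normc.

Lemma normr_normc (z : R[i]) : `|z| = (normc z)%:C.
Proof. by []. Qed.

Lemma normc_ge0 (z : R[i]) : 0 <= normc z.
Proof. by rewrite -ler0c -normr_normc. Qed.

(** The i-th diagonal entry of A^2 is the sum over j of A_ij A_ji, and A_ji is the conjugate of
    A_ij. *)
Lemma frob_norm_sqr n (A : 'M[R[i]]_n) : A \is hermsymmx ->
  (frob_norm A ^+ 2)%:C = \tr (A ^+ 2).
Proof.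
move=> /hermsymmxP hA; rewrite sqr_sqrtr; last first.
  by apply: sumr_ge0 => i _; apply: sumr_ge0 => j _; rewrite sqr_ge0.
rewrite rmorph_sum /mxtrace; apply: eq_bigr => i _.
rewrite expr2 -mulmxE mxE rmorph_sum; apply: eq_bigr => j _.
by rewrite -{3}hA !mxE rmorphXn /= -normr_normc normCK.
Qed.

Lemma frob_norm_sqrD n (A B : 'M[R[i]]_n) :
  A \is hermsymmx -> B \is hermsymmx ->
  (frob_norm A ^+ 2 + frob_norm B ^+ 2)%:C = \tr (A ^+ 2) + \tr (B ^+ 2).
Proof.
move=> hA hB; apply: etrans (congr2 +%R (frob_norm_sqr hA) (frob_norm_sqr hB)).
exact: (rmorphD (real_complex R)).
Qed.

Lemma l2_norm_sqr n (v : 'cV[R[i]]_n) :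
  (l2_norm v ^+ 2)%:C = (v^t* *m v) 0 0.
Proof.
rewrite sqr_sqrtr; last by apply: sumr_ge0 => i _; rewrite sqr_ge0.
rewrite rmorph_sum mxE; apply: eq_bigr => i _.
by rewrite !mxE rmorphXn /= -normr_normc normCKC.
Qed.

Lemma l2_norm_ge0 n (v : 'cV[R[i]]_n) : 0 <= l2_norm v.
Proof. exact: sqrtr_ge0. Qed.

Lemma l2_normZ n (a : R[i]) (v : 'cV[R[i]]_n) :
  l2_norm (a *: v) = normc a * l2_norm v.
Proof.
apply/eqP; rewrite -(@eqrXn2 _ 2) ?mulr_ge0 ?l2_norm_ge0 ?normc_ge0 //.
apply/eqP/complexI; rewrite l2_norm_sqr exprMn rmorphM /= l2_norm_sqr.
rewrite rmorphXn /= -normr_normc.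
by rewrite trmxC_scale -scalemxAl -scalemxAr scalerA !mxE normCKC.
Qed.

Lemma normc_le_l2_norm n (v : 'cV[R[i]]_n) i : normc (v i 0) <= l2_norm v.
Proof.
rewrite -(ger0_norm (normc_ge0 _)) -sqrtr_sqr ler_sqrt; last first.
  by apply: sumr_ge0 => j _; rewrite sqr_ge0.
by rewrite (bigD1 i) //= lerDl sumr_ge0 // => j _; rewrite sqr_ge0.
Qed.

(** This makes the [sup] in [op_norm] a genuine upper bound. The bound comes from the row sums of
    moduli, as every coordinate of a vector in the unit ball has modulus at most 1. *)
Lemma op_norm_has_ubound n (A : 'M[R[i]]_n) :
  has_ubound
    [set l2_norm (A *m v) | v in [set v : 'cV[R[i]]_n | l2_norm v <= 1]].
Proof.
exists (Num.sqrt (\sum_i (\sum_j normc (A i j)) ^+ 2)) => _ [v /= v1 <-].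
have sge0 i : 0 <= \sum_j normc (A i j) by apply: sumr_ge0 => j _; exact: normc_ge0.
rewrite ler_sqrt; last by apply: sumr_ge0 => i _; rewrite sqr_ge0.
apply: ler_sum => i _; rewrite ler_pXn2r ?nnegrE ?normc_ge0 //.
rewrite -lecR -normr_normc mxE rmorph_sum.
apply: le_trans (ler_norm_sum _ _ _) _; apply: ler_sum => j _.
rewrite normrM !normr_normc -rmorphM lecR ler_piMr ?normc_ge0 //.
exact: le_trans (normc_le_l2_norm v j) v1.
Qed.

Lemma normc_spectral_diag_le n (A : 'M[R[i]]_n) i : A \is hermsymmx ->
  normc (spectral_diag A 0 i) <= op_norm A.
Proof.
move=> hA; have v1 : l2_norm (spectral_vec A i) = 1.
  apply/eqP; rewrite -(@eqrXn2 _ 2) ?l2_norm_ge0 // expr1n.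
  by apply/eqP/complexI; rewrite l2_norm_sqr spectral_vec_unit.
apply: ub_le_sup; first exact: op_norm_has_ubound.
exists (spectral_vec A i); first by rewrite /= v1.
by rewrite spectral_vec_eigen // l2_normZ v1 mulr1.
Qed.

(** The matrix is diagonal in the eigenbasis of A with entries 1 - t d_i, and |t d_i| is at most |t|
    times the operator norm, hence less than 1. *)
Lemma posdefmx_1sub n (A : 'M[R[i]]_n) (t : R) : A \is hermsymmx ->
  (`|t|%:E < (op_norm A)%:E^-1)%E -> posdefmx (1%:M - t%:C *: A).
Proof.
move=> hA ht; have hU := spectral_unitarymx A.
have -> : 1%:M - t%:C *: A = (spectralmx A)^t*
    *m diag_mx (\row_i (1 - t%:C * spectral_diag A 0 i)) *m spectralmx A.
  have -> : \row_i (1 - t%:C * spectral_diag A 0 i)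
      = const_mx 1 - t%:C *: spectral_diag A by apply/rowP => i; rewrite !mxE.
  rewrite raddfB /= [diag_mx (_ *: _)]linearZ /= diag_const_mx.
  rewrite mulmxBr mulmxBl mulmx1.
  by rewrite unitary_adjointK // -scalemxAr -scalemxAl -hermitian_spectral.
apply: posdefmx_unitary_diag => // i; rewrite mxE subr_gt0.
have le_op := normc_spectral_diag_le i hA.
have /mxOverP/(_ 0 i)/complex_realP[x dx] := hermitian_spectral_diag_real hA.
move: le_op; rewrite dx -rmorphM ltcR -lecR -normr_normc.
have -> : `|x%:C| = `|x|%:C by rewrite normc_def /= expr0n addr0 sqrtr_sqr.
rewrite lecR => le_op; apply: le_lt_trans (ler_norm _) _; rewrite normrM.
apply: le_lt_trans (ler_wpM2l (normr_ge0 t) le_op) _.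
have op0 : 0 <= op_norm A by exact: le_trans le_op.
(* If the operator norm is 0, its inverse is +oo and t is unrestricted, but the product to be
   bounded is 0. *)
move: ht; rewrite inver; case: eqVneq => [->|opn0 ht]; first by rewrite mulr0.
have op_gt0 : 0 < op_norm A by rewrite lt_def opn0.
by rewrite -ltr_pdivlMr // div1r -lte_fin.
Qed.

End ComplexNorms.

Theorem corollary1p3 (R : realType) (n : nat) (A B C D : 'M[R[i]]_n)
    (hA : A \is hermsymmx) (hB : B \is hermsymmx) (hC : C \is hermsymmx)
    (leAB : lemx A B) (leBC : lemx B C) (hD : D = A + C - B) :
  [/\ \det (expmx A) * \det (expmx C) = \det (expmx B) * \det (expmx D),
      \det (expmx (B ^+ 2)) * \det (expmx (D ^+ 2))
        <= \det (expmx (A ^+ 2)) * \det (expmx (C ^+ 2))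
      /\ frob_norm B ^+ 2 + frob_norm D ^+ 2
        <= frob_norm A ^+ 2 + frob_norm C ^+ 2
    & forall t : R,
        (- ((op_norm A)%:E)^-1 < t%:E < ((op_norm C)%:E)^-1)%E ->
        \det (1%:M - t%:C *: A) * \det (1%:M - t%:C *: C)
          <= \det (1%:M - t%:C *: B) * \det (1%:M - t%:C *: D)].
Proof.
move: leAB leBC => [hP pP] [hQ pQ].
(* P and Q are introduced with equations, not as local definitions, so that they stay opaque and can
   be rewritten in either direction. *)
have [P eP] : exists P, P = B - A by exists (B - A).
have [Q eQ] : exists Q, Q = C - B by exists (C - B).
rewrite -eP in hP pP; rewrite -eQ in hQ pQ.
have eB : B = A + P by rewrite eP addrC subrK.
have eC : C = A + P + Q by rewrite -eB eQ addrC subrK.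
have eD : D = A + Q by rewrite hD eQ addrA.
have hDh : D \is hermsymmx by rewrite eD; exact: (hermsymmxD hA hQ).
have tr2 : \tr (B ^+ 2) + \tr (D ^+ 2) <= \tr (A ^+ 2) + \tr (C ^+ 2).
  by rewrite eB eD eC; exact: (mxtrace_sqr_add_le A hP pP pQ).
have hA2 := hermsymmx_sqr hA; have hB2 := hermsymmx_sqr hB.
have hC2 := hermsymmx_sqr hC; have hD2 := hermsymmx_sqr hDh.
split.
- apply: etrans (det_expmx_mul hA hC) (etrans _ (esym (det_expmx_mul hB hDh))).
  congr (expR (complex.Re _))%:C.
  by rewrite -!mxtraceD hD (addrC B) subrK.
- split; first exact: (det_expmx_mul_le hB2 hD2 hA2 hC2).
  (* Embedded in [R[i]], the inequality between squared norms is the trace inequality [tr2]. *)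
  rewrite -lecR.
  by rewrite [leLHS](frob_norm_sqrD hB hDh) [leRHS](frob_norm_sqrD hA hC).
move=> t /andP[tA tC].
have psdZ (M : 'M[R[i]]_n) (s : R) : 0 <= s ->
    (forall v : 'cV[R[i]]_n, 0 <= (v^t* *m M *m v) 0 0) ->
    forall v : 'cV[R[i]]_n, 0 <= (v^t* *m (s%:C *: M) *m v) 0 0.
  by move=> s0 pM v; rewrite -scalemxAr -scalemxAl mxE mulr_ge0 ?ler0c.
have hermZ (M : 'M[R[i]]_n) (s : R) : M \is hermsymmx -> s%:C *: M \is hermsymmx.
  by apply: hermsymmxZ; apply/complex_realP; exists s.
(* The base X has to be the least of the four matrices. For t >= 0 it is 1 - tC, and the others add
   t Q, t P or both; for t <= 0 it is 1 - tA, and the increments are -t P and -t Q. *)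
have [t0|/ltW t0] := leP 0 t.
  have pX : posdefmx (1%:M - t%:C *: C).
    by apply: (posdefmx_1sub hC); rewrite (ger0_norm t0).
  have eXQ : 1%:M - t%:C *: B = 1%:M - t%:C *: C + t%:C *: Q.
    by rewrite eQ; apply/matrixP => i j; rewrite !mxE; ring.
  have eXP : 1%:M - t%:C *: D = 1%:M - t%:C *: C + t%:C *: P.
    by rewrite hD eP; apply/matrixP => i j; rewrite !mxE; ring.
  have eXQP : 1%:M - t%:C *: A = 1%:M - t%:C *: C + t%:C *: Q + t%:C *: P.
    by rewrite eP eQ; apply/matrixP => i j; rewrite !mxE; ring.
  rewrite eXQ eXP eXQP mulrC.
  exact: (det_add_submul_psd pX (hermZ _ t hQ) (psdZ _ _ t0 pQ)
            (hermZ _ t hP) (psdZ _ _ t0 pP)).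
have pX : posdefmx (1%:M - t%:C *: A).
  (* Here |t| = -t, so the left end of the interval gives the required bound after negation in the
     extended reals. *)
  by apply: (posdefmx_1sub hA); rewrite (ler0_norm t0) EFinN lteNl.
have eXP : 1%:M - t%:C *: B = 1%:M - t%:C *: A + (- t)%:C *: P.
  by rewrite eP; apply/matrixP => i j; rewrite rmorphN !mxE; ring.
have eXQ : 1%:M - t%:C *: D = 1%:M - t%:C *: A + (- t)%:C *: Q.
  by rewrite hD eQ; apply/matrixP => i j; rewrite rmorphN !mxE; ring.
have eXPQ : 1%:M - t%:C *: C = 1%:M - t%:C *: A + (- t)%:C *: P + (- t)%:C *: Q.
  by rewrite eP eQ; apply/matrixP => i j; rewrite rmorphN !mxE; ring.
rewrite eXP eXQ eXPQ.
have nt0 : 0 <= - t by rewrite oppr_ge0.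
exact: (det_add_submul_psd pX (hermZ _ (- t) hP) (psdZ _ _ nt0 pP)
          (hermZ _ (- t) hQ) (psdZ _ _ nt0 pQ)).
Qed.
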